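(* Suppose $\eta$ is a random particle configuration, and that the distribution of the corresponding path encoding $S$ is supported on $\mathcal{S}^{rev}$. Then any two of the three following conditions imply the third: \[\overleftarrow{\eta}\overset{d}{=}\eta,\qquad \bar{W}\overset{d}{=}W,\qquad T\eta\overset{d}{=}\eta.\] Moreover, in the case that two of the three conditions $\overleftarrow{\eta}\overset{d}{=}\eta$, $\bar{W}\overset{d}{=}W$, $T\eta\overset{d}{=}\eta$ are satisfied, the distribution of $S$ is actually supported on $\mathcal{S}^{inv}$.
   Context: A particle configuration is $\eta=(\eta_n)_{n\in\mathbb{Z}}\in\{0,1\}^{\mathbb{Z}}$. Its path encoding is $S=(S_n)_{n\in\mathbb{Z}}$ with $S_0=0$, $S_n-S_{n-1}=1-2\eta_n$, an element of $\mathcal{S}^0=\{S:\mathbb{Z}\to\mathbb{Z} : S_0=0,\ |S_n-S_{n-1}|=1\ \forall n\}$. Let $M_n=\sup_{m\le n}S_m$, $I_n=\inf_{m\ge n}S_m$. $TS$ is well-defined iff $M_0<\infty$, with $(TS)_n=2M_n-S_n-2M_0$; $T^{-1}S$ is well-defined iff $I_0>-\infty$, with $(T^{-1}S)_n=2I_n-S_n-2I_0$. $T\eta$ is the configuration with path encoding $TS$. Define \[\mathcal{S}^{rev}=\{S\in \mathcal{S}^0 : TS,\ T^{-1}S,\ T^{-1}TS,\ TT^{-1}S\text{ well-defined},\ T^{-1}TS=S,\ TT^{-1}S=S\},\] \[\mathcal{S}^{inv}=\{S\in \mathcal{S}^{0} : T^kS\in \mathcal{S}^{rev}\text{ for all }k\in\mathbb{Z}\}.\]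 The carrier process is $W_n=M_n-S_n$; the reversed configuration is $\overleftarrow{\eta}_n=\eta_{-(n-1)}$ and the reversed carrier is $\bar{W}_n=W_{-n}$. ''Supported on $A$'' means that $S\in A$ almost surely. *)

(* Defs.v *)
From HB Require Import structures.
From mathcomp Require Import all_boot all_order all_algebra.
From mathcomp Require Import all_classical all_reals all_analysis.
From mathcomp Require Import zify ring lra.

Set Implicit Arguments.
Unset Strict Implicit.
Unset Printing Implicit Defensive.

Import Order.TTheory GRing.Theory Num.Theory.

Local Open Scope classical_set_scope.
Local Open Scope ring_scope.

(* The canonical product sigma-algebra on X^Z. It is meant for a countable
   discrete X (bool and int here), whose sigma-algebra is its full power set:
   this is why B is an arbitrary set. *)
Definition cylinders (X : Type) : set (set (int -> X)) :=
  [set A | exists (n : int) (B : set X), A = [set x | B (x n)]].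

Notation config := (g_sigma_algebraType (@cylinders bool)).

HB.instance Definition _ := isPointed.Build int 0.

Notation zseq := (g_sigma_algebraType (@cylinders int)).

Definition eq_in_law (d d' : measure_display) (Omega : measurableType d)
    (E : measurableType d') (R : realType) (P : probability Omega R)
    (X Y : Omega -> E) : Prop :=
  forall A : set E, measurable A -> P (X @^-1` A) = P (Y @^-1` A).

(* The S with S_0 = 0 and S_n - S_{n-1} = 1 - 2 eta_n for all n in Z; see
   path_encoding0, path_encodingB and path_encoding_unique. *)
Definition path_encoding (eta : config) : zseq := fun n =>
  match n with
  | Posz k => \sum_(i < k) (1 - 2 * (eta i.+1%:Z)%:R)
  | Negz k => - \sum_(i < k.+1) (1 - 2 * (eta (- i%:Z))%:R)
  end.

Definition S0 : set zseq :=
  [set S : zseq | S 0 = 0 /\ forall n : int, `|S n - S (n - 1)| = 1].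

(* A particle sits at n exactly when the path goes down between n-1 and n. *)
Definition config_of (S : zseq) : config := fun n => S n - S (n - 1) == -1.

Definition past_values (S : zseq) (n : int) : set int :=
  [set S m | m in [set m : int | m <= n]].
Definition future_values (S : zseq) (n : int) : set int :=
  [set S m | m in [set m : int | n <= m]].

(* [supremum 0] and [infimum 0] take the junk value 0 on unbounded sets. For
   S in S0, finiteness of M_n (resp. I_n) does not depend on n. *)
Definition past_max (S : zseq) : zseq := fun n => supremum 0 (past_values S n).
Definition future_min (S : zseq) : zseq :=
  fun n => infimum 0 (future_values S n).

(* M_0 < +oo and I_0 > -oo. *)
Definition T_defined (S : zseq) : Prop := has_ubound (past_values S 0).
Definition Tinv_defined (S : zseq) : Prop := has_lbound (future_values S 0).

Definition T (S : zseq) : zseq :=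
  fun n => 2 * past_max S n - S n - 2 * past_max S 0.
Definition Tinv (S : zseq) : zseq :=
  fun n => 2 * future_min S n - S n - 2 * future_min S 0.

Definition Tpow (k : int) (S : zseq) : zseq :=
  match k with
  | Posz j => iter j T S
  | Negz j => iter j.+1 Tinv S
  end.

Definition Srev : set zseq :=
  [set S | S0 S /\
     [/\ T_defined S, Tinv_defined S, Tinv_defined (T S) & T_defined (Tinv S)] /\
     Tinv (T S) = S /\ T (Tinv S) = S].

(* Tpow is total, but requiring all the T^k S to be in Srev makes each of them
   well-defined, by induction on |k|. *)
Definition Sinv : set zseq := [set S | forall k : int, Srev (Tpow k S)].

Definition T_config (eta : config) : config := config_of (T (path_encoding eta)).

Definition rev_config (eta : config) : config := fun n => eta (- (n - 1)).

Definition carrier (eta : config) : zseq :=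
  fun n => past_max (path_encoding eta) n - path_encoding eta n.

Definition rev_carrier (eta : config) : zseq := fun n => carrier eta (- n).

Lemma path_encoding0 (eta : config) : path_encoding eta 0 = 0.
Proof. exact: big_ord0. Qed.

Lemma path_encodingB (eta : config) (n : int) :
  path_encoding eta n - path_encoding eta (n - 1) = 1 - 2 * (eta n)%:R.
Proof.
case: n => [[|k]|k].
- have -> : Posz 0 - 1 = Negz 0 by [].
  by rewrite /path_encoding big_ord0 big_ord_recr big_ord0 /= !add0r opprK.
- have -> : Posz k.+1 - 1 = k by lia.
  by rewrite /path_encoding big_ord_recr /= addrAC subrr add0r.
- have -> : Negz k - 1 = Negz k.+1 by lia.
  rewrite /path_encoding [X in _ - - X]big_ord_recr /= opprK.
  by rewrite addrA addNr add0r NegzE.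
Qed.

Lemma path_encoding_S0 (eta : config) : S0 (path_encoding eta).
Proof.
split=> [|n]; first exact: path_encoding0.
by rewrite path_encodingB; case: (eta n).
Qed.

Lemma path_encoding_unique (eta : config) (S : zseq) : S 0 = 0 ->
  (forall n : int, S n - S (n - 1) = 1 - 2 * (eta n)%:R) ->
  S = path_encoding eta.
Proof.
move=> S00 SB; apply/funext => n.
elim/int_ind: n => [|k IH|k IH].
- by rewrite S00 path_encoding0.
- move: (SB k.+1%:Z) (path_encodingB eta k.+1%:Z).
  have -> : (k.+1%:Z - 1) = k%:Z by lia.
  by rewrite IH => <- /addIr.
- move: (SB (- k%:Z)) (path_encodingB eta (- k%:Z)).
  have -> : (- k%:Z - 1) = - (k.+1)%:Z by lia.
  by rewrite IH => <- /addrI /oppr_inj.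
Qed.

Lemma config_ofK (S : zseq) : S0 S -> path_encoding (config_of S) = S.
Proof.
move=> [S00 SB]; apply/esym/path_encoding_unique => // n.
rewrite /config_of; have := SB n.
by move: (S n - S (n - 1)) => x; case: eqP => [->//|] /=; lia.
Qed.

Lemma path_encodingK (eta : config) : config_of (path_encoding eta) = eta.
Proof.
by apply/funext => n; rewrite /config_of path_encodingB; case: (eta n).
Qed.

(* Main.v *)
(* Write R for the reversal S_n |-> - S_(-n) of paths, which encodes the reversal
   of configurations. If T^-1 T S = S then the future minimum of TS at n is
   M_n - 2 M_0, so the carrier of R T S is the reversed carrier of S. Since a
   configuration is recovered from its carrier W (a particle sits where W
   increases), the carrier is reversible in law iff R T eta =d eta. As R is an
   involution, any two of R eta =d eta, R T eta =d eta, T eta =d eta imply the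
   third. Finally T eta =d eta gives T^k eta =d eta for all integers k (for k < 0
   because T^-1 T eta = eta a.s.), so almost surely every T^k S lies in the
   measurable set Srev. *)
Require Import Defs.
From mathcomp Require Import all_boot all_order all_algebra.
From mathcomp Require Import all_classical all_reals all_analysis.
From mathcomp Require Import zify.

Set Implicit Arguments.
Unset Strict Implicit.
Unset Printing Implicit Defensive.

Import Order.TTheory GRing.Theory Num.Theory.

Local Open Scope classical_set_scope.
Local Open Scope ring_scope.

(** * Path encodings, reversal and the carrier *)

(** Both operations default to 0, which is its own opposite, so empty and unbounded sets are covered
    too. Facts on past maxima thus pass to future minima without any boundedness assumption. *)
Lemma infimumN (A : set int) : infimum 0 A = - supremum 0 (-%R @` A).
Proof.
have supE x : supremums (-%R @` A) (- x) <-> infimums A x.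
  split=> -[bd opt]; (split; first exact/lb_ubN).
    by move=> y /lb_ubN /opt; rewrite lerN2.
  by move=> y; rewrite -(opprK y) lerN2 => /lb_ubN /opt.
rewrite /infimum /supremum.
have [->|A0] := eqVneq A set0; first by rewrite image_set0 eqxx oppr0.
have /negPf -> : -%R @` A != set0.
  by have /set0P[x Ax] := A0; apply/set0P; exists (- x), x.
have [[x infx]|noinf] := pselect (exists x, infimums A x).
  rewrite (xget_subset1 _ infx (@is_subset1_infimums _ _ _)).
  have supx := (supE x).2 infx.
  by rewrite (xget_subset1 _ supx (@is_subset1_supremums _ _ _)) opprK.
rewrite !xgetPN ?oppr0// => x ?; apply: noinf; last by exists x.
by exists (- x); apply/supE; rewrite opprK.
Qed.

Lemma past_maxE (S : zseq) (m n : int) : m <= n ->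
  (forall k, k <= n -> S k <= S m) -> past_max S n = S m.
Proof.
move=> mn mmax; rewrite /past_max /supremum.
case: ifPn => [/eqP E|_].
  by have : past_values S n (S m) by [exists m]; rewrite E.
apply: xget_subset1; last exact: is_subset1_supremums.
by split=> [_ [k kn <-]|y]; [exact: mmax|apply; exists m].
Qed.

Lemma past_max_attained (S : zseq) (n : int) : has_ubound (past_values S n) ->
  exists2 m, m <= n & past_max S n = S m /\ forall k, k <= n -> S k <= S m.
Proof.
move=> [u ubu].
(* A nonempty set of integers bounded above has a greatest element, found here as the least of the
   negated values. *)
have [||_ [[_ [m mn <-] <-] mmax]] :=
    @int_lbound_has_minimum (-%R @` past_values S n) (- u).
- by exists (- S n), (S n) => //; exists n => /=.
- by move=> _ [x /ubu + <-]; lia.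
have {}mmax k : k <= n -> S k <= S m.
  by move=> kn; rewrite -lerN2; apply: mmax; exists (S k) => //; exists k.
by exists m => //; split; first exact: past_maxE.
Qed.

Lemma past_max_out (S : zseq) (n : int) :
  ~ has_ubound (past_values S n) -> past_max S n = 0.
Proof. by move=> nub; apply: supremum_out => -[_]. Qed.

(** The sign compensates for running time backwards: the increment at n is the increment of S at 1 -
    n. *)
Definition rev_path (S : zseq) : zseq := fun n => - S (- n).

Lemma past_values_rev (S : zseq) (n : int) :
  past_values (rev_path S) n = -%R @` future_values S (- n).
Proof.
rewrite /past_values /future_values image_comp; apply/seteqP; split => x [m /= mn <-].
  by exists (- m) => //=; lia.
by exists (- m); rewrite /rev_path ?opprK//=; lia.
Qed.

Lemma future_minE (S : zseq) (n : int) :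
  future_min S n = - past_max (rev_path S) (- n).
Proof. by rewrite /past_max past_values_rev opprK -infimumN. Qed.

(** Reversal exchanges past maxima and future minima. The identity includes the junk values, so that
    measurability of [Tinv] reduces to that of [T]. *)
Lemma Tinv_rev (S : zseq) : Tinv S = rev_path (T (rev_path S)).
Proof.
apply/funext => n; rewrite /Tinv /rev_path/T -/(rev_path S) !future_minE oppr0.
by rewrite /rev_path !opprK; move: (past_max _ _) (past_max _ _) (S n) => x y z; lia.
Qed.

Lemma Tinv_defined_rev (S : zseq) : Tinv_defined S <-> T_defined (rev_path S).
Proof.
by rewrite /Tinv_defined /T_defined past_values_rev oppr0; apply: has_lb_ubN.
Qed.

Lemma S0_le_norm (S : zseq) : S0 S -> forall n, S n <= `|n|.
Proof.
move=> [S00 SB]; suff S_norm n : `|S n| <= `|n| by move=> n; have := S_norm n; lia.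
elim/int_ind: n => [|k IH|k IH]; first by rewrite S00.
  have := SB k.+1%:Z; have -> : k.+1%:Z - 1 = k%:Z by lia.
  by lia.
have := SB (- k%:Z); have -> : - k%:Z - 1 = - (k.+1)%:Z by lia.
by lia.
Qed.

Lemma T_defined_has_ubound (S : zseq) (n : int) :
  S0 S -> T_defined S -> has_ubound (past_values S n).
Proof.
move=> SS [b ubb]; exists (b + `|n|) => _ [m /= mn <-].
have b0 : 0 <= b by apply: ubb; exists 0 => //=; rewrite SS.1.
have [m0|m0] := leP m 0; last by have := S0_le_norm SS m; lia.
by have : S m <= b by [apply: ubb; exists m]; lia.
Qed.

Lemma past_max_ge (S : zseq) (m n : int) : S0 S -> T_defined S ->
  m <= n -> S m <= past_max S n.
Proof.
move=> SS TS mn.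
by have [k _ [->]] := past_max_attained (T_defined_has_ubound n SS TS); apply.
Qed.

Lemma past_max_succ (S : zseq) (n : int) : S0 S -> T_defined S ->
  past_max S n = Num.max (past_max S (n - 1)) (S n).
Proof.
move=> SS TS.
have [m mn [-> mmax]] := past_max_attained (T_defined_has_ubound (n - 1) SS TS).
have nmax k : k <= n -> k = n \/ k <= n - 1 by lia.
case: leP => Smn.
- by apply: past_maxE => // k /nmax[-> //|/mmax]; lia.
- by apply: past_maxE; [lia|move=> k /nmax[->|/mmax]; lia].
Qed.

(** If the past maximum stays constant, the step of S is reversed. If it grows, it grows by 1
    together with S, and the up-step is kept. *)
Lemma T_S0 (S : zseq) : S0 S -> T_defined S -> S0 (T S).
Proof.
move=> SS TS; split; first by rewrite /T SS.1; lia.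
move=> n; rewrite /T past_max_succ//.
have := SS.2 n; have := past_max_ge SS TS (lexx (n - 1)).
by move: (past_max S _) (past_max S _) (S _) (S _) => a b x y; lia.
Qed.

Lemma future_min_attainedE (S : zseq) (m n : int) : n <= m ->
  (forall k, n <= k -> S m <= S k) -> future_min S n = S m.
Proof.
move=> nm mmin; rewrite future_minE (@past_maxE _ (- m)) /rev_path ?opprK//.
  by lia.
by move=> k kn; rewrite lerN2; apply: mmin; lia.
Qed.

(* [Tinv (T S) = S] only says that the future minimum of [T S] and the past
   maximum of [S] have the same increments; the additive constant is fixed at a
   time where [S] attains its past maximum. *)
Lemma future_min_T (S : zseq) (n : int) : Srev S ->
  future_min (T S) n = past_max S n - 2 * past_max S 0.
Proof.
move=> [SS [[TS _ _ _] [TK _]]].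
have [m m0 [M0 mmax]] := past_max_attained (T_defined_has_ubound 0 SS TS).
have Mm : past_max S m = S m by apply: past_maxE => // k km; apply: mmax; lia.
(* At time m the path [T S] is at -S_m. For k >= m its value 2 M_k - S_k - 2 S_m is at least M_k - 2
   S_m, hence at least -S_m. *)
have Im : future_min (T S) m = T S m.
  apply: future_min_attainedE => // k mk; rewrite /T Mm M0.
  have := past_max_ge SS TS mk; have := past_max_ge SS TS (lexx k).
  by move: (past_max S k) (S m) (S k) => a x y; lia.
have TmE := congr1 (fun U : zseq => U m) TK.
have TnE := congr1 (fun U : zseq => U n) TK.
move: Im TmE TnE; rewrite /Tinv /T -/(T S) Mm M0.
move: (future_min _ _) (future_min _ _) (future_min _ _) (past_max S n) (S m) (S n).
by move=> a b c x y z; lia.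
Qed.

Lemma path_encoding_rev (eta : config) :
  path_encoding (rev_config eta) = rev_path (path_encoding eta).
Proof.
apply/esym/path_encoding_unique => [|n].
  by rewrite /rev_path oppr0 path_encoding0.
have := path_encodingB eta (- (n - 1)); rewrite /rev_path /rev_config.
have -> : - (n - 1) - 1 = - n by lia.
by move=> <-; rewrite addrC opprK.
Qed.

Lemma path_encoding_T (eta : config) : T_defined (path_encoding eta) ->
  path_encoding (T_config eta) = T (path_encoding eta).
Proof. by move=> Teta; apply/config_ofK/T_S0 => //; exact: path_encoding_S0. Qed.

Lemma rev_configK : involutive rev_config.
Proof.
by move=> eta; apply/funext => n; rewrite /rev_config; congr (eta _); lia.
Qed.

(** By [future_min_T], the reversal of [T S] has past maximum 2 M_0 - M_(-n) at n, and its value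
    there is 2 M_0 + S_(-n) - 2 M_(-n). The difference is W_(-n). *)
Lemma carrier_rev_T (eta : config) : Srev (path_encoding eta) ->
  carrier (rev_config (T_config eta)) = rev_carrier eta.
Proof.
move=> Seta; have [_ [[Teta _ _ _] _]] := Seta.
apply/funext => n; rewrite /rev_carrier /carrier path_encoding_rev path_encoding_T//.
have := future_min_T (- n) Seta; rewrite future_minE opprK.
have revTn : rev_path (T (path_encoding eta)) n = - T (path_encoding eta) (- n) by [].
rewrite revTn [T _ (- n)]/T.
move: (past_max _ _) (past_max _ _) (past_max _ _) (path_encoding _ _).
by move=> a b c x; lia.
Qed.

Definition config_of_carrier (W : zseq) : config := fun n => W (n - 1) < W n.

(** A particle lowers S and leaves M unchanged, so W grows. At an empty site S rises by 1 and M by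
    at most 1, so W does not grow. *)
Lemma carrierK (eta : config) : T_defined (path_encoding eta) ->
  config_of_carrier (carrier eta) = eta.
Proof.
move=> Teta; apply/funext => n; rewrite /config_of_carrier /carrier.
have SS := path_encoding_S0 eta.
rewrite (past_max_succ n)//; have := path_encodingB eta n.
have := past_max_ge SS Teta (lexx (n - 1)).
move: (past_max _ _) (path_encoding _ _) (path_encoding _ _) => a b c.
by case: (eta n) => /=; lia.
Qed.

(** This makes [carrierK] applicable to the reversal of [T_config eta]. *)
Lemma T_defined_rev_T (eta : config) : Srev (path_encoding eta) ->
  T_defined (path_encoding (rev_config (T_config eta))).
Proof.
move=> [_ [[Teta _ ITeta _] _]].
by rewrite path_encoding_rev path_encoding_T//; exact/Tinv_defined_rev.
Qed.

(** * Measurability *)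

(** Measurability for the power set sigma-algebra on the values, so that any function whatsoever may
    be applied to them. *)
Definition measurable_discrete (d : measure_display) (Omega : measurableType d)
    (C : Type) (f : Omega -> C) : Prop :=
  forall B : set C, measurable (f @^-1` B).

Section discrete.
Context (d : measure_display) (Omega : measurableType d).

Lemma measurable_existsT (I : countType) (P : I -> set Omega) :
  (forall i, measurable (P i)) -> measurable [set w | exists i, P i w].
Proof.
move=> mP; rewrite (_ : mkset _ = \bigcup_i P i); last first.
  by apply/seteqP; split=> w [i]; exists i.
exact: countable_bigcupT_measurable.
Qed.

Lemma measurable_forallT (I : countType) (P : I -> set Omega) :
  (forall i, measurable (P i)) -> measurable [set w | forall i, P i w].
Proof.
move=> mP; rewrite (_ : mkset _ = ~` [set w | exists i, (~` P i) w]).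
  by apply/measurableC/measurable_existsT => i; exact: measurableC.
apply/seteqP; split=> w /= => [Pw [i]|nP i]; first by apply; exact: Pw.
by apply: contrapT => nPi; apply: nP; exists i.
Qed.

Lemma measurable_discrete_fiber (C : countType) (f : Omega -> C) :
  (forall c, measurable [set w | f w = c]) -> measurable_discrete f.
Proof.
move=> mf B.
(* The union runs over the whole countable type; the second factor, full or empty, keeps only the
   fibers over B. *)
rewrite (_ : _ @^-1` _ = [set w | exists c, (f @^-1` [set c] `&` [set _ | B c]) w]).
  apply: measurable_existsT => c; apply: measurableI; first exact: mf.
  have [Bc|nBc] := pselect (B c).
    by rewrite (_ : [set _ | B c] = setT)//; apply/seteqP; split.
  by rewrite (_ : [set _ | B c] = set0)//; apply/seteqP; split.
by apply/seteqP; split=> w /= => [?|[c [<-]]] //; exists (f w).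
Qed.

Lemma measurable_discrete_pair (C D : countType) (f : Omega -> C) (g : Omega -> D) :
  measurable_discrete f -> measurable_discrete g ->
  measurable_discrete (fun w => (f w, g w)).
Proof.
move=> mf mg; apply: measurable_discrete_fiber => -[a b].
rewrite (_ : mkset _ = f @^-1` [set a] `&` g @^-1` [set b]).
  exact: measurableI.
by apply/seteqP; split=> w /= => [[]|[-> ->]].
Qed.

Lemma measurable_discrete_comp (C D : Type) (h : C -> D) (f : Omega -> C) :
  measurable_discrete f -> measurable_discrete (fun w => h (f w)).
Proof. by move=> mf B; exact: (mf (h @^-1` B)). Qed.

Lemma measurable_discrete_comp2 (C D : countType) (E : Type) (h : C -> D -> E)
    (f : Omega -> C) (g : Omega -> D) :
  measurable_discrete f -> measurable_discrete g ->
  measurable_discrete (fun w => h (f w) (g w)).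
Proof.
move=> mf mg.
exact: (measurable_discrete_comp (fun x => h x.1 x.2) (measurable_discrete_pair mf mg)).
Qed.

Lemma measurable_discrete_sum (V : countNmodType) (k : nat) (f : nat -> Omega -> V) :
  (forall i, measurable_discrete (f i)) ->
  measurable_discrete (fun w => \sum_(i < k) f i w).
Proof.
move=> mf; elim: k => [|k IH].
  under eq_fun do rewrite big_ord0.
  by move=> B; rewrite preimage_cst; case: ifP.
under eq_fun do rewrite big_ord_recr.
exact: (measurable_discrete_comp2 +%R IH (mf k)).
Qed.

(** The cylinders generate the sigma-algebra, so it is enough to test preimages of cylinders. *)
Lemma measurable_cylindersP (X : pointedType)
    (f : Omega -> g_sigma_algebraType (@cylinders X)) :
  measurable_fun setT f <-> forall n, measurable_discrete (fun w => f w n).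
Proof.
split=> [mf n B|mf].
  rewrite -[_ @^-1` _]setTI; apply: (mf measurableT [set x | B (x n)]).
  by apply: sub_sigma_algebra; exists n, B.
refine (@measurability _ _ _ _ _ f (@cylinders X) erefl _).
by move=> _ [_ [n [B ->]] <-]; rewrite setTI; exact: mf.
Qed.

Lemma measurable_cylinder (X : pointedType)
    (f : Omega -> g_sigma_algebraType (@cylinders X)) :
  measurable_fun setT f -> forall n, measurable_discrete (fun w => f w n).
Proof. by move/measurable_cylindersP. Qed.

End discrete.

Lemma measurable_coord (X : pointedType) (n : int) :
  measurable_discrete (fun x : g_sigma_algebraType (@cylinders X) => x n).
Proof. exact: measurable_cylinder (@measurable_id _ _ setT) n. Qed.

(* The last disjunct is the junk value 0 of an unbounded past. It matters because
   laws are compared through preimages, so the maps below must be measurable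
   everywhere and not only on Srev. *)
Lemma past_max_eqP (S : zseq) (n z : int) : past_max S n = z <->
  ((exists m, m <= n /\ S m = z) /\ (forall m, m <= n -> S m <= z)) \/
  (forall b, exists m, [/\ m <= n, b < S m & z = 0]).
Proof.
have [ubS|nubS] := pselect (has_ubound (past_values S n)).
  have [m mn [Mn mmax]] := past_max_attained ubS; rewrite Mn; split=> [<-|].
    by left; split; [exists m|].
  move=> [[[k [kn <-]] kmax]|unbd].
    by have := mmax k kn; have := kmax m mn; move: (S k) (S m) => x y; lia.
  by have [k [/mmax Skm /(le_lt_trans Skm)]] := unbd (S m); rewrite ltxx.
have unbd b : exists m, m <= n /\ b < S m.
  apply: contrapT => nb; apply: nubS; exists b => _ [m /= mn <-].
  by rewrite leNgt; apply/negP => bm; apply: nb; exists m.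
rewrite past_max_out//; split=> [<-|].
  by right=> b; have [m [? ?]] := unbd b; exists m.
move=> [[_ zmax]|/(_ 0)[m []//]].
by have [m [/zmax Sz /(le_lt_trans Sz)]] := unbd z; rewrite ltxx.
Qed.

(** Times and bounds range over the integers, so [past_max_eqP] describes each fiber by countable
    unions and intersections of one-coordinate events. *)
Lemma measurable_past_max : measurable_fun setT past_max.
Proof.
apply/measurable_cylindersP => n; apply: measurable_discrete_fiber => z.
rewrite (_ : mkset _ =
    ([set S : zseq | exists m, m <= n /\ S m = z] `&`
     [set S : zseq | forall m, m <= n -> S m <= z]) `|`
    [set S : zseq | forall b, exists m, [/\ m <= n, b < S m & z = 0]]); last first.
  by apply/seteqP; split=> S /past_max_eqP.
apply: measurableU; first apply: measurableI.
- apply: measurable_existsT => m.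
  exact: (@measurable_coord _ m [set x | m <= n /\ x = z]).
- apply: measurable_forallT => m.
  exact: (@measurable_coord _ m [set x | m <= n -> x <= z]).
- apply: measurable_forallT => b; apply: measurable_existsT => m.
  exact: (@measurable_coord _ m [set x | [/\ m <= n, b < x & z = 0]]).
Qed.

Lemma measurable_T : measurable_fun setT T.
Proof.
have mM := measurable_cylinder measurable_past_max.
apply/measurable_cylindersP => n; rewrite /T.
apply: (measurable_discrete_comp2 (fun x y => x - 2 * y)); last exact: mM.
by apply: (measurable_discrete_comp2 (fun x y => 2 * x - y));
  [exact: mM|exact: measurable_coord].
Qed.

Lemma measurable_rev_path : measurable_fun setT rev_path.
Proof.
apply/measurable_cylindersP => n.
exact: (measurable_discrete_comp -%R (@measurable_coord int (- n))).
Qed.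

Lemma measurable_Tinv : measurable_fun setT Tinv.
Proof.
rewrite (_ : Tinv = rev_path \o (T \o rev_path)); last first.
  by apply/funext => S; exact: Tinv_rev.
apply: measurableT_comp measurable_rev_path _.
exact: measurableT_comp measurable_T measurable_rev_path.
Qed.

Lemma measurable_path_encoding : measurable_fun setT path_encoding.
Proof.
apply/measurable_cylindersP => -[k|k]; rewrite /path_encoding.
  apply: (@measurable_discrete_sum _ _ _ _
    (fun i (w : config) => 1 - 2 * (w i.+1%:Z)%:R)) => i.
  exact: (measurable_discrete_comp (fun x : bool => 1 - 2 * x%:R) (measurable_coord _)).
apply: (measurable_discrete_comp -%R).
apply: (@measurable_discrete_sum _ _ _ _
    (fun i (w : config) => 1 - 2 * (w (- i%:Z))%:R)) => i.
exact: (measurable_discrete_comp (fun x : bool => 1 - 2 * x%:R) (measurable_coord _)).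
Qed.

Lemma measurable_config_of : measurable_fun setT config_of.
Proof.
apply/measurable_cylindersP => n.
by apply: (measurable_discrete_comp2 (fun x y => x - y == -1)); exact: measurable_coord.
Qed.

Lemma measurable_config_of_carrier : measurable_fun setT config_of_carrier.
Proof.
apply/measurable_cylindersP => n.
by apply: (measurable_discrete_comp2 (fun x y : int => x < y)); exact: measurable_coord.
Qed.

Lemma measurable_T_config : measurable_fun setT T_config.
Proof.
apply: measurableT_comp measurable_config_of _.
exact: measurableT_comp measurable_T measurable_path_encoding.
Qed.

Lemma measurable_rev_config : measurable_fun setT rev_config.
Proof. by apply/measurable_cylindersP => n; exact: measurable_coord. Qed.

Lemma measurable_carrier : measurable_fun setT carrier.
Proof.
have mM : measurable_fun setT (past_max \o path_encoding).
  exact: measurableT_comp measurable_past_max measurable_path_encoding.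
apply/measurable_cylindersP => n.
exact: (measurable_discrete_comp2 (fun x y => x - y) (measurable_cylinder mM n)
  (measurable_cylinder measurable_path_encoding n)).
Qed.

Lemma measurable_rev_carrier : measurable_fun setT rev_carrier.
Proof.
by apply/measurable_cylindersP => n; exact: (measurable_cylinder measurable_carrier).
Qed.

Lemma measurable_T_defined : measurable [set S | T_defined S].
Proof.
rewrite (_ : mkset _ = [set S : zseq | exists b, forall m, m <= 0 -> S m <= b]).
  apply: measurable_existsT => b; apply: measurable_forallT => m.
  exact: (@measurable_coord _ m [set x | m <= 0 -> x <= b]).
apply/seteqP; split=> S [b ubb]; exists b; first by move=> m m0; apply: ubb; exists m.
by move=> _ [m m0 <-]; exact: ubb.
Qed.

Lemma measurable_Tinv_defined : measurable [set S | Tinv_defined S].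
Proof.
rewrite (_ : mkset _ = rev_path @^-1` [set S | T_defined S]).
  rewrite -[_ @^-1` _]setTI; apply: measurable_rev_path => //.
  exact: measurable_T_defined.
by apply/seteqP; split=> S /Tinv_defined_rev.
Qed.

Lemma measurable_eq_zseq (f g : zseq -> zseq) : measurable_fun setT f ->
  measurable_fun setT g -> measurable [set S | f S = g S].
Proof.
move=> mf mg; rewrite (_ : mkset _ = [set S | forall n, f S n - g S n = 0]); last first.
  apply/seteqP; split=> S /= => [->|fg]; first by move=> n; rewrite subrr.
  by apply/funext => n; apply/subr0_eq/fg.
apply: measurable_forallT => n.
exact: (measurable_discrete_comp2 (fun x y => x - y) (measurable_cylinder mf n)
  (measurable_cylinder mg n) [set 0]).
Qed.

(** Membership in [Srev] can then be transferred between random paths with the same law. *)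
Lemma measurable_Srev : measurable Srev.
Proof.
have mS0 : measurable S0.
  apply: measurableI; first exact: (@measurable_coord int 0 [set 0]).
  apply: measurable_forallT => n.
  exact: (measurable_discrete_comp2 (fun x y : int => `|x - y|)
    (@measurable_coord int n)
    (@measurable_coord int (n - 1)) [set 1]).
rewrite (_ : Srev = S0 `&`
  (([set S | T_defined S] `&` [set S | Tinv_defined S] `&`
    T @^-1` [set S | Tinv_defined S] `&` Tinv @^-1` [set S | T_defined S]) `&`
   ([set S | (Tinv \o T) S = S] `&` [set S | (T \o Tinv) S = S]))); last first.
  apply/seteqP; split=> S.
    by move=> [? [[? ? ? ?] [? ?]]].
  by move=> [? [[[[? ?] ?] ?] [? ?]]].
have [mT mTinv] := (measurable_T, measurable_Tinv).
have mTIT : measurable (T @^-1` [set S | Tinv_defined S]).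
  by rewrite -[T @^-1` _]setTI; apply: mT => //; exact: measurable_Tinv_defined.
have mTTI : measurable (Tinv @^-1` [set S | T_defined S]).
  by rewrite -[Tinv @^-1` _]setTI; apply: mTinv => //; exact: measurable_T_defined.
have [mTd mTId] := (measurable_T_defined, measurable_Tinv_defined).
apply: measurableI => //; apply: measurableI.
  by apply: measurableI => //; apply: measurableI => //; exact: measurableI.
apply: measurableI; apply: (@measurable_eq_zseq _ id) => //; try exact: measurable_id.
  exact: measurableT_comp mTinv mT.
exact: measurableT_comp mT mTinv.
Qed.

(** * Equality in law *)

Section law.
Context (d : measure_display) (Omega : measurableType d) (R : realType)
  (P : probability Omega R).

Lemma eq_in_law_sym (d' : measure_display) (E : measurableType d')
    (X Y : Omega -> E) : eq_in_law P X Y -> eq_in_law P Y X.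
Proof. by move=> XY A mA; rewrite XY. Qed.

Lemma eq_in_law_trans (d' : measure_display) (E : measurableType d')
    (X Y Z : Omega -> E) :
  eq_in_law P X Y -> eq_in_law P Y Z -> eq_in_law P X Z.
Proof. by move=> XY YZ A mA; rewrite XY ?YZ. Qed.

Lemma eq_in_law_comp (d1 d2 : measure_display) (E1 : measurableType d1)
    (E2 : measurableType d2) (f : E1 -> E2) (X Y : Omega -> E1) :
  measurable_fun setT f -> eq_in_law P X Y ->
  eq_in_law P (fun w => f (X w)) (fun w => f (Y w)).
Proof.
move=> mf XY A mA; apply: (XY (f @^-1` A)).
by rewrite -[_ @^-1` _]setTI; exact: mf.
Qed.

Lemma eq_in_law_ae (d' : measure_display) (E : measurableType d')
    (X Y : Omega -> E) : measurable_fun setT X -> measurable_fun setT Y ->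
  {ae P, forall w, X w = Y w} -> eq_in_law P X Y.
Proof.
move=> mX mY [N [mN N0 XYN]] A mA.
have mXA : measurable (X @^-1` A) by rewrite -[_ @^-1` _]setTI; exact: mX.
have mYA : measurable (Y @^-1` A) by rewrite -[_ @^-1` _]setTI; exact: mY.
(* Removing the null set N changes no probability, and outside N the two preimages coincide. *)
have mass B : measurable B -> P B = P (B `\` N).
  move=> mB; have BN0 : P (B `&` N) = 0%E.
    apply: (subset_measure0 (B := N)) => //; exact: measurableI.
  by rewrite (measureDI P mB mN) [X in (_ + X)%E]BN0 adde0.
rewrite (mass _ mXA) (mass _ mYA); congr (P _); apply/seteqP.
have XY w : ~ N w -> X w = Y w.
  by move=> nN; apply: contrapT => nXY; exact/nN/XYN.
by split=> w [Aw nN]; split=> //; rewrite /= ?XY// -XY.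
Qed.

(** The complement of A is measurable and null for the law of Y, hence null for that of X. *)
Lemma eq_in_law_ae_mem (d' : measure_display) (E : measurableType d')
    (X Y : Omega -> E) (A : set E) : measurable A ->
  measurable_fun setT X -> measurable_fun setT Y ->
  eq_in_law P X Y -> {ae P, forall w, A (Y w)} -> {ae P, forall w, A (X w)}.
Proof.
move=> mA mX mY XY AY; exists (X @^-1` (~` A)).
have mAC : measurable (~` A) by exact: measurableC.
have mXA : measurable (X @^-1` (~` A)) by rewrite -[_ @^-1` _]setTI; exact: mX.
have mYA : measurable (Y @^-1` (~` A)) by rewrite -[_ @^-1` _]setTI; exact: mY.
by split=> //; rewrite XY//; exact: measure_negligible AY.
Qed.

End law.

(** Equality in law passes through [carrier] in one direction and through [config_of_carrier] in the
    other. The latter recovers both configurations by [carrierK], since their paths almost surely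
    have a bounded past. *)
Lemma rev_carrier_law (d : measure_display) (Omega : measurableType d)
    (R : realType) (P : probability Omega R) (eta : {RV P >-> config}) :
  {ae P, forall w, Srev (path_encoding (eta w))} ->
  eq_in_law P (fun w => rev_carrier (eta w)) (fun w => carrier (eta w)) <->
  eq_in_law P (fun w => rev_config (T_config (eta w))) eta.
Proof.
move=> eta_rev.
have meta : measurable_fun setT eta by exact: measurable_funPT.
have mRT : measurable_fun setT (fun w => rev_config (T_config (eta w))).
  apply: (measurableT_comp measurable_rev_config).
  exact: (measurableT_comp measurable_T_config).
have mcarrier (X : Omega -> config) : measurable_fun setT X ->
    measurable_fun setT (fun w => carrier (X w)).
  by move=> mX; exact: (measurableT_comp measurable_carrier).
have mback (X : Omega -> zseq) : measurable_fun setT X ->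
    measurable_fun setT (fun w => config_of_carrier (X w)).
  by move=> mX; exact: (measurableT_comp measurable_config_of_carrier).
have carrierRT : eq_in_law P
    (fun w => carrier (rev_config (T_config (eta w)))) (fun w => rev_carrier (eta w)).
  apply: eq_in_law_ae; first exact: mcarrier.
    exact: (measurableT_comp measurable_rev_carrier).
  by apply: filterS eta_rev => w; exact: carrier_rev_T.
split=> [WW|RT].
  have recover (X : Omega -> config) : measurable_fun setT X ->
      {ae P, forall w, T_defined (path_encoding (X w))} ->
      eq_in_law P (fun w => config_of_carrier (carrier (X w))) X.
    move=> mX TX; apply: eq_in_law_ae => //; first exact/mback/mcarrier.
    by apply: filterS TX => w; exact: carrierK.
  have TRT : {ae P, forall w,
      T_defined (path_encoding (rev_config (T_config (eta w))))}.
    by apply: filterS eta_rev => w; exact: T_defined_rev_T.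
  have Teta : {ae P, forall w, T_defined (path_encoding (eta w))}.
    by apply: filterS eta_rev => w [_ [[]]].
  apply: eq_in_law_trans (eq_in_law_sym (recover _ mRT TRT)) _.
  apply: eq_in_law_trans (recover _ meta Teta).
  apply: eq_in_law_comp measurable_config_of_carrier _.
  exact: eq_in_law_trans carrierRT WW.
apply: eq_in_law_trans (eq_in_law_sym carrierRT) _.
exact: eq_in_law_comp measurable_carrier RT.
Qed.

Lemma eq_in_law_iter (d d' : measure_display) (Omega : measurableType d)
    (E : measurableType d') (R : realType) (P : probability Omega R)
    (f : E -> E) (X : Omega -> E) (k : nat) : measurable_fun setT f ->
  eq_in_law P (fun w => f (X w)) X -> eq_in_law P (fun w => iter k f (X w)) X.
Proof.
move=> mf fX; elim: k => [|k IH]; first by [].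
exact: eq_in_law_trans (eq_in_law_comp mf IH) fX.
Qed.

Lemma measurable_iter (d : measure_display) (E : measurableType d)
    (f : E -> E) (k : nat) : measurable_fun setT f -> measurable_fun setT (iter k f).
Proof.
by move=> mf; elim: k => [|k IH]; [exact: measurable_id|exact: measurableT_comp mf IH].
Qed.

Lemma T_invariant_Sinv (d : measure_display) (Omega : measurableType d)
    (R : realType) (P : probability Omega R) (eta : {RV P >-> config}) :
  {ae P, forall w, Srev (path_encoding (eta w))} ->
  eq_in_law P (fun w => T_config (eta w)) eta ->
  {ae P, forall w, Sinv (path_encoding (eta w))}.
Proof.
move=> eta_rev T_inv; pose S w := path_encoding (eta w).
have mS : measurable_fun setT S.
  apply: measurableT_comp measurable_path_encoding _; exact: measurable_funPT.
have mfS (f : zseq -> zseq) : measurable_fun setT f ->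
    measurable_fun setT (fun w => f (S w)).
  by move=> mf; exact: measurableT_comp mf mS.
(* The encoding of [T_config eta] is [T S] where [T] is well-defined, hence almost surely. *)
have TS : eq_in_law P (fun w => T (S w)) S.
  apply: eq_in_law_trans (eq_in_law_comp measurable_path_encoding T_inv).
  apply: eq_in_law_ae; first exact: mfS measurable_T.
    apply: measurableT_comp measurable_path_encoding _.
    apply: measurableT_comp measurable_T_config _; exact: measurable_funPT.
  by apply: filterS eta_rev => w [_ [[Teta _ _ _] _]]; rewrite path_encoding_T.
(* Applying [Tinv] to both sides of the invariance under [T] compares [Tinv S] with [Tinv (T S)],
   which is almost surely S. *)
have TinvS : eq_in_law P (fun w => Tinv (S w)) S.
  apply: eq_in_law_trans (eq_in_law_comp measurable_Tinv (eq_in_law_sym TS)) _.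
  apply: eq_in_law_ae => //.
    exact: measurableT_comp measurable_Tinv (mfS _ measurable_T).
  by apply: filterS eta_rev => w [_ [_ []]].
(* Each iterate has the law of S and so lies in [Srev] almost surely; countably many null sets are
   then discarded together. *)
have iter_rev (f : zseq -> zseq) : measurable_fun setT f ->
    eq_in_law P (fun w => f (S w)) S ->
    {ae P, forall w, forall k, Srev (iter k f (S w))}.
  move=> mf fS; apply: ae_foralln => k.
  apply: (eq_in_law_ae_mem (Y := S)) => //; first exact: measurable_Srev.
    exact/mfS/measurable_iter.
  exact: eq_in_law_iter.
apply: filterS2 (iter_rev _ measurable_T TS) (iter_rev _ measurable_Tinv TinvS).
by move=> w Tk Tinvk [k|k]; [exact: Tk|exact: Tinvk].
Qed.

Theorem theorem1p7 (d : measure_display) (Omega : measurableType d)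
    (R : realType) (P : probability Omega R) (eta : {RV P >-> config})
    (eta_rev : {ae P, forall w, Srev (path_encoding (eta w))}) :
  let rev_inv := eq_in_law P (fun w => rev_config (eta w)) eta in
  let carrier_rev_inv :=
    eq_in_law P (fun w => rev_carrier (eta w)) (fun w => carrier (eta w)) in
  let T_inv := eq_in_law P (fun w => T_config (eta w)) eta in
  [/\ rev_inv -> carrier_rev_inv -> T_inv,
      rev_inv -> T_inv -> carrier_rev_inv,
      carrier_rev_inv -> T_inv -> rev_inv
    & [\/ rev_inv /\ carrier_rev_inv, rev_inv /\ T_inv
        | carrier_rev_inv /\ T_inv] ->
      {ae P, forall w, Sinv (path_encoding (eta w))}].
Proof.
move=> rev_inv carrier_rev_inv T_inv.
have RT := rev_carrier_law eta_rev.
(* Reversing both sides of R T eta =d eta cancels the outer R. *)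
have T_rev : carrier_rev_inv ->
    eq_in_law P (fun w => T_config (eta w)) (fun w => rev_config (eta w)).
  move=> /RT /(eq_in_law_comp measurable_rev_config).
  rewrite (_ : (fun w => rev_config (rev_config _)) = fun w => T_config (eta w))//.
  by apply/funext => w; rewrite rev_configK.
have rev_carrier_T : rev_inv -> carrier_rev_inv -> T_inv.
  by move=> rev_eta /T_rev T_eta; exact: eq_in_law_trans rev_eta.
split=> //.
(* Here R T eta =d R eta by invariance under [T], and R eta =d eta. *)
- move=> rev_eta /(eq_in_law_comp measurable_rev_config) RT_eta.
  by apply/RT; exact: eq_in_law_trans rev_eta.
- by move=> /T_rev /eq_in_law_sym T_eta T_eta'; exact: eq_in_law_trans T_eta'.
(* Every pair yields invariance under [T]; only the pair of the two reversal conditions requires a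
   deduction. *)
- move=> two; apply: T_invariant_Sinv eta_rev _.
  by case: two => -[] //; exact: rev_carrier_T.
Qed.
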